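(* For any integer $k\geq 3$, $$gr_k^{*}(K_{3}: K_{1, m})= \begin{cases} 2m-2, & \text{if } m\geq 12 \text{ is even},\\ m, & \text{if } m\geq 3 \text{ is odd}.\end{cases}$$
   Context: $K_{1,m}$ is the star with $m$ edges. A $k$-edge-coloring uses colors from $[k]=\{1,\ldots,k\}$. A subgraph is monochromatic if all its edges have the same color and rainbow if no two of its edges have the same color. The Gallai-Ramsey number $gr_k(K_3: H)$ is the smallest integer $n$ such that every $k$-edge-colored $K_n$ contains either a rainbow $K_3$ or a monochromatic copy of $H$. For $n=gr_k(K_3:H)$ and $0\le s\le n-1$, $K_{n-1}\sqcup K_{1,s}$ denotes the graph obtained from $K_{n-1}$ by adding a new vertex $v$ and $s$ edges joining $v$ to $s$ vertices of $K_{n-1}$. The star-critical Gallai-Ramsey number $gr_k^{*}(K_3: H)$ is the smallest integer $s$ such that every $k$-edge-colored $K_{n-1}\sqcup K_{1,s}$ contains either a rainbow $K_3$ or a monochromatic copy of $H$. *)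

(* Defs.v *)
From HB Require Import structures.
From mathcomp Require Import all_boot.

Set Implicit Arguments.
Unset Strict Implicit.
Unset Printing Implicit Defensive.

Record sgraph := SGraph {
  vertex :> finType;
  adj : rel vertex;
  adj_sym : symmetric adj;
  adj_irrefl : irreflexive adj }.

Definition edges (G : sgraph) : {set {set G}} :=
  [set [set p.1; p.2] | p : G * G & adj p.1 p.2].

Section Complete.
Variable n : nat.
Definition complete_adj : rel 'I_n := fun x y => x != y.
Lemma complete_sym : symmetric complete_adj.
Proof. by move=> x y; rewrite /complete_adj eq_sym. Qed.
Lemma complete_irrefl : irreflexive complete_adj.
Proof. by move=> x; rewrite /complete_adj eqxx. Qed.
Definition complete : sgraph := SGraph complete_sym complete_irrefl.
End Complete.

(* The star with m edges: centre None, leaves Some i. *)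
Section Star.
Variable m : nat.
Definition star_adj : rel (option 'I_m) := fun x y => isSome x != isSome y.
Lemma star_sym : symmetric star_adj.
Proof. by move=> x y; rewrite /star_adj eq_sym. Qed.
Lemma star_irrefl : irreflexive star_adj.
Proof. by move=> x; rewrite /star_adj eqxx. Qed.
Definition star : sgraph := SGraph star_sym star_irrefl.
End Star.

(* K_N with a new vertex None joined to s of its vertices. All choices of the s
   neighbours give isomorphic graphs; we take the first s. For s > N the graph
   is the same as for s = N. *)
Section CompleteStar.
Variables N s : nat.
Definition complete_star_adj : rel (option 'I_N) := fun x y =>
  match x, y with
  | Some i, Some j => i != j
  | None, Some i | Some i, None => i < s
  | None, None => false
  end.
Lemma complete_star_sym : symmetric complete_star_adj.
Proof. by case=> [i|] [j|] //=; rewrite eq_sym. Qed.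
Lemma complete_star_irrefl : irreflexive complete_star_adj.
Proof. by case=> [i|] //=; rewrite eqxx. Qed.
Definition complete_star : sgraph :=
  SGraph complete_star_sym complete_star_irrefl.
End CompleteStar.

(* Only the values on [edges G] matter; the values on other sets are never
   inspected by the predicates below. Not every colour has to be used. *)
Definition edge_coloring (k : nat) (G : sgraph) := {set G} -> 'I_k.

(* f exhibits a (not necessarily induced) copy of H in G. *)
Definition is_copy (H G : sgraph) (f : H -> G) : Prop :=
  injective f /\ forall x y : H, adj x y -> adj (f x) (f y).

Definition has_mono_copy k (H G : sgraph) (c : edge_coloring k G) : Prop :=
  exists f : H -> G, is_copy f /\
    {in edges H &, forall e e' : {set H}, c (f @: e) = c (f @: e')}.

Definition has_rainbow_copy k (H G : sgraph) (c : edge_coloring k G) : Prop :=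
  exists f : H -> G, is_copy f /\
    {in edges H &, injective (fun e : {set H} => c (f @: e))}.

Definition gallai_ramsey_prop (k : nat) (H G : sgraph) : Prop :=
  forall c : edge_coloring k G,
    has_rainbow_copy (complete 3) c \/ has_mono_copy H c.

Definition is_least (P : nat -> Prop) (n : nat) : Prop :=
  P n /\ forall n', P n' -> n <= n'.

(* gr_k(K_3 : H) = n *)
Definition is_gallai_ramsey (k : nat) (H : sgraph) (n : nat) : Prop :=
  is_least (fun n => gallai_ramsey_prop k H (complete n)) n.

(* gr*_k(K_3 : H) = s; this includes the existence of gr_k(K_3 : H). *)
Definition is_star_critical (k : nat) (H : sgraph) (s : nat) : Prop :=
  exists n, is_gallai_ramsey k H n /\
    is_least (fun s => s <= n.-1 /\
                gallai_ramsey_prop k H (complete_star n.-1 s)) s.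

(* Main.v *)
(* Upper bounds. By Gallai's theorem (a color that is used but disconnected splits
   the vertices into components joined monochromatically; at most two colors are
   connected), a coloring without rainbow triangle is a substitution into a
   2-colored complete graph. If all color degrees are at most D = m - 1 and
   3N > 7D, every part has at least N - 2D > D/3 vertices, so every part sees at
   most two others in each color; this leaves only the blow-up of the pentagon,
   fewer parts being excluded by counting. Two parts always have a common
   neighboring part in one color, so together they have at most D vertices, which
   fixes all part sizes: they are equal for odd m, and one part has m/2 vertices
   and the others m/2 - 1 for even m. The extra vertex v cannot use a saturated
   color, and avoiding rainbow triangles then makes its edges monochromatic
   (m odd), or, for m even, forces an edge of each pentagon color from v into the
   large part, which overloads an end of the edge between these two neighbors.
   Lower bounds. Blow up the pentagon and use a third color inside the parts. For m
   odd, v is joined to m - 1 vertices in the third color; for m even, v is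
   added to a part of size m/2 - 1 and misses exactly the one part for which this
   would create a vertex of degree m. *)
Require Import Defs.
From mathcomp Require Import all_boot zify.

Set Implicit Arguments.
Unset Strict Implicit.
Unset Printing Implicit Defensive.

(** Colors live on ordered pairs; symmetry of [col] is a separate hypothesis, and diagonal values
    never matter. *)
Definition triangle_rainbow_free (V K : eqType) (col : V -> V -> K) :=
  forall x y z, x != y -> y != z -> x != z ->
    [|| col x y == col y z, col x y == col x z | col y z == col x z].

(** * Gallai partitions *)

Section GallaiPartition.

Variables (V : finType) (K : eqType) (col : V -> V -> K).
Hypothesis colC : forall x y, col x y = col y x.
Hypothesis col_free : triangle_rainbow_free col.

Implicit Types (A : {set V}) (a b c : K).

Definition mono_rel A a : rel V :=
  fun x y => [&& x \in A, y \in A, x != y & col x y == a].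

Lemma mono_rel_sym A a : symmetric (mono_rel A a).
Proof.
by move=> x y; rewrite /mono_rel colC eq_sym andbA [(x \in A) && _]andbC -andbA.
Qed.

Lemma mono_csym A a : connect_sym (mono_rel A a).
Proof. exact: sym_connect_sym (mono_rel_sym A a). Qed.

(** By induction on a path from [x] to [x']: if [x z] is an edge of color [a] and neither end is
    joined to [y] in color [a], the triangle [x z y] forces its other two edges to agree. *)
Lemma col_component A a x x' y :
    y \in A -> connect (mono_rel A a) x x' -> ~~ connect (mono_rel A a) x y ->
  col x y = col x' y.
Proof.
move=> yA /connectP[p]; elim: p x => [|z p IHp] x /= => [_ -> //|].
case/andP=> xz zp def_x' nxy.
have nzy : ~~ connect (mono_rel A a) z y.
  by apply: contra nxy; apply: connect_trans (connect1 xz).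
rewrite -(IHp z) //; case/and4P: (xz) => xA zA neq_xz /eqP xz_a.
have neq_zy : z != y by apply: contraNneq nzy => ->; rewrite connect0.
have neq_xy : x != y by apply: contraNneq nxy => ->; rewrite connect0.
have zy_a : col z y != a.
  by apply: contraNneq nzy => zy; apply: connect1; rewrite /mono_rel zA yA neq_zy zy /=.
have xy_a : col x y != a.
  by apply: contraNneq nxy => xy; apply: connect1; rewrite /mono_rel xA yA neq_xy xy /=.
have := col_free neq_xz neq_zy neq_xy.
by rewrite xz_a ![a == _]eq_sym (negPf zy_a) (negPf xy_a) => /eqP.
Qed.

Definition connected_in A a :=
  [forall x in A, forall y in A, connect (mono_rel A a) x y].

Lemma connected_in_nbr A a v u :
    connected_in A a -> v \in A -> u \in A -> u != v ->
  exists2 x, x \in A :\ v & col v x = a.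
Proof.
move=> /forall_inP cA vA uA neq_uv.
have /connectP[[|x p] /= + def_u] := forall_inP (cA v vA) u uA.
  by rewrite def_u eqxx in neq_uv.
case/andP=> /and4P[_ xA neq_vx /eqP vx] _; exists x => //.
by rewrite !inE eq_sym neq_vx.
Qed.

(** A component of [A :\ v] without an [a]-neighbor of [v] would remain closed under [a]-edges in
    all of [A], and so would cut off [v]. *)
Lemma connected_in_component A a v w :
    connected_in A a -> v \in A -> w \in A :\ v ->
  exists2 x, connect (mono_rel (A :\ v) a) w x & (x \in A :\ v) && (col v x == a).
Proof.
move=> /forall_inP cA vA wA'; have := wA'; rewrite !inE => /andP[neq_wv wA].
pose C := [pred x | (x \in A :\ v) && connect (mono_rel (A :\ v) a) w x].
case: (pickP [pred x | C x & col v x == a]) => [x /= /andP[/andP[xA wx] vx]|noC].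
  by exists x; rewrite ?xA.
have clC : closed (mono_rel A a) C.
  apply: intro_closed; first exact: mono_csym.
  move=> x y /and4P[xA yA neq_xy xy] /andP[xA' wx].
  have neq_yv : y != v.
    apply/eqP => def_y; have := noC x.
    by rewrite /= xA' wx colC -def_y xy.
  have yA' : y \in A :\ v by rewrite !inE neq_yv.
  rewrite !inE yA neq_yv /=; apply: connect_trans wx (connect1 _).
  by rewrite /mono_rel xA' yA' neq_xy xy.
have := closed_connect clC (forall_inP (cA w wA) v vA).
by rewrite !inE eqxx neq_wv wA connect0.
Qed.

(** Take a [b]-neighbor [y] and a [c]-neighbor [z] of [v], and suppose [A :\ v] has several
    [a]-components. If [y] and [z] lie in different ones, the edge [y z] has both colors [b] and
    [c]. If they lie in the same one, a vertex outside it is joined to [y] in [b] and to [z] in [c],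
    against [col_component]. *)
Lemma delete_vertex_connected A a b c v :
    a != b -> a != c -> b != c -> v \in A -> 1 < #|A| ->
    connected_in A a -> connected_in A b -> connected_in A c ->
  connected_in (A :\ v) a.
Proof.
move=> neq_ab neq_ac neq_bc vA A_gt1 cAa cAb cAc.
have [u uA neq_uv] : exists2 u, u \in A & u != v.
  move: A_gt1; rewrite (cardsD1 v) vA ltnS card_gt0 => /set0Pn[u].
  by rewrite !inE => /andP[]; exists u.
have [y yA' vy] := connected_in_nbr cAb vA uA neq_uv.
have [z zA' vz] := connected_in_nbr cAc vA uA neq_uv.
set E := mono_rel (A :\ v) a.
(* An edge [vy] of color [d <> a] forces color [d] between [y] and every
   other [a]-component, as that component has an [a]-neighbour of [v]. *)
have outside d t w : a != d -> t \in A :\ v -> col v t = d -> w \in A :\ v ->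
    ~~ connect E w t -> col w t = d.
  move=> neq_ad tA' vt wA' nwt.
  have [x wx /andP[xA' /eqP vx]] := connected_in_component cAa vA wA'.
  rewrite (col_component tA' wx nwt).
  have nxt : ~~ connect E x t by apply: contra nwt; apply: connect_trans wx.
  have neq_xt : x != t by apply: contraNneq nxt => ->; rewrite connect0.
  have xt : col x t != a.
    by apply: contraNneq nxt => xt; apply: connect1; rewrite /E /mono_rel xA' tA' neq_xt xt /=.
  have neq_vx : v != x by move: xA'; rewrite !inE eq_sym => /andP[].
  have neq_vt : v != t by move: tA'; rewrite !inE eq_sym => /andP[].
  have := col_free neq_vx neq_xt neq_vt.
  by rewrite vx vt eq_sym (negPf xt) (negPf neq_ad) => /eqP.
apply: contraT => /forall_inPn[w1 w1A' /forall_inPn[w2 w2A' nw12]].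
have [yz|nyz] := boolP (connect E y z); last first.
  have zy : col z y = b by apply: outside; rewrite // mono_csym.
  by have := outside c z y neq_ac zA' vz yA' nyz; rewrite colC zy => /eqP /(negP neq_bc).
have [w wA' nwy] : exists2 w, w \in A :\ v & ~~ connect E w y.
  have [w1y|] := boolP (connect E w1 y); last by exists w1.
  exists w2 => //; apply: contra nw12 => w2y.
  by apply: connect_trans w1y _; rewrite mono_csym.
have nwz : ~~ connect E w z.
  by apply: contra nwy => wz; apply: connect_trans wz _; rewrite mono_csym.
have wy := outside b y w neq_ab yA' vy wA' nwy.
have wz := outside c z w neq_ac zA' vz wA' nwz.
have := col_component wA' yz.
by rewrite mono_csym nwy ![col _ w]colC wy wz => /(_ isT) /eqP /(negP neq_bc).
Qed.

(** Infinite descent: deleting a vertex keeps all three colors connected. *)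
Lemma three_colors_disconnected A a b c :
    a != b -> a != c -> b != c -> 1 < #|A| ->
  ~ [/\ connected_in A a, connected_in A b & connected_in A c].
Proof.
move=> neq_ab neq_ac neq_bc.
have [n] := ubnP #|A|; elim: n A => // n IHn A; rewrite ltnS => leAn A_gt1.
case=> cAa cAb cAc; have /card_gt1P[v [u [vA uA neq_vu]]] := A_gt1.
have neq_uv : u != v by rewrite eq_sym.
apply: (IHn (A :\ v)).
- by apply: leq_trans leAn; rewrite [X in _ < X](cardsD1 v) vA.
(* Neighbors of [v] in two different colors are distinct, so two vertices survive the deletion. *)
- have [y yA' vy] := connected_in_nbr cAa vA uA neq_uv.
  have [z zA' vz] := connected_in_nbr cAb vA uA neq_uv.
  apply/card_gt1P; exists y, z; split=> //.
  by apply: contraNneq neq_ab => eq_yz; rewrite -vy -vz eq_yz.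
- by split; [ apply: (@delete_vertex_connected A a b c)
            | apply: (@delete_vertex_connected A b a c)
            | apply: (@delete_vertex_connected A c a b) ]; rewrite // eq_sym.
Qed.

(* The parts are the fibres of [f], and the idempotent [f] maps every vertex to
   the representative of its part. *)
Lemma gallai_partition_in A :
    1 < #|A| ->
  exists (f : V -> V) (R B : K),
    [/\ {in A, forall x, f x \in A}, {in A, forall x, f (f x) = f x},
        exists x y, [/\ x \in A, y \in A & f x != f y] &
        {in A &, forall x y, f x != f y ->
           col x y = col (f x) (f y) /\ (col x y = R \/ col x y = B)}].
Proof.
have [n] := ubnP #|A|; elim: n A => // n IHn A; rewrite ltnS => leAn A_gt1.
pose bad p := [&& p.1 \in A, p.2 \in A, p.1 != p.2 & ~~ connected_in A (col p.1 p.2)].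
case: (pickP bad) => [[x0 y0] /and4P[/= x0A y0A neq_xy0 ndA]|noBad].
  (* A color that occurs in [A] without connecting it: its components are contracted to their roots.
     There are fewer roots than vertices because the edge [x0 y0] lies inside a component, so
     induction applies to them. *)
  set a := col x0 y0 in ndA; pose E := mono_rel A a; pose rho := root E.
  have csE : connect_sym E := mono_csym A a.
  have rhoA : {in A, forall x, rho x \in A}.
    move=> x xA; have clA : closed E A by move=> ? ? /and3P[-> ->].
    by rewrite -(closed_connect clA (connect_root E x)).
  have rhoE x y : (rho x == rho y) = connect E x y by rewrite /rho root_connect.
  have homog : {in A &, forall x y, rho x != rho y -> col x y = col (rho x) (rho y)}.
    move=> x y xA yA; rewrite rhoE => nxy.
    rewrite (col_component yA (connect_root E x) nxy) colC [RHS]colC.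
    apply: col_component (connect_root E y) _; first exact: rhoA.
    by rewrite csE -rhoE /rho root_root // rhoE.
  have S_gt1 : 1 < #|rho @: A|.
    move: ndA => /forall_inPn[u uA /forall_inPn[w wA nuw]].
    apply/card_gt1P; exists (rho u), (rho w); split; rewrite ?imset_f //.
    by rewrite rhoE.
  have S_ltn : #|rho @: A| < n.
    apply: leq_trans leAn; rewrite ltn_neqAle leq_imset_card andbT.
    apply/imset_injP => inj_rho; move: (neq_xy0); rewrite (inj_rho x0 y0) ?eqxx //.
    apply/eqP; rewrite rhoE; apply: connect1.
    by rewrite /E /mono_rel x0A y0A neq_xy0 eqxx.
  have [g [R [B [gS gK [u [w [uS wS neq_uw]]] gcol]]]] := IHn _ S_ltn S_gt1.
  have rhoK : {in rho @: A, forall x, rho x = x}.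
    by move=> _ /imsetP[x xA ->]; rewrite /rho root_root.
  have SA : {subset rho @: A <= A} by move=> _ /imsetP[x xA ->]; apply: rhoA.
  have rhoS x : x \in A -> rho x \in rho @: A by apply: imset_f.
  exists (g \o rho), R, B; split=> /=.
  - by move=> x xA; apply/SA/gS/rhoS.
  - by move=> x xA; rewrite rhoK ?gK ?gS ?rhoS.
  - by exists u, w; rewrite !rhoK // !SA.
  move=> x y xA yA neq_g; have neq_rho : rho x != rho y by apply: contraNneq neq_g => ->.
  rewrite homog //; exact: gcol (rhoS x xA) (rhoS y yA) neq_g.
have conn x y : x \in A -> y \in A -> x != y -> connected_in A (col x y).
  by move=> xA yA neq_xy; apply: contraFT (noBad (x, y)) => ?; apply/and4P.
have /card_gt1P[x0 [y0 [x0A y0A neq_xy0]]] := A_gt1.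
(* Now every occurring color connects [A], so at most two colors occur and the parts can be single
   vertices. [B] is a second color if there is one, and otherwise repeats the first. *)
pose other p := [&& p.1 \in A, p.2 \in A, p.1 != p.2 & col p.1 p.2 != col x0 y0].
exists id, (col x0 y0).
exists (if [pick p | other p] is Some p then col p.1 p.2 else col x0 y0).
split=> //; first by exists x0, y0.
move=> x y xA yA neq_xy; split=> //.
case: pickP => [[x1 y1] /and4P[/= x1A y1A neq_xy1 neq10]|/(_ (x, y))].
  have [->|neq0] := eqVneq (col x y) (col x0 y0); first by left.
  have [->|neq1] := eqVneq (col x y) (col x1 y1); first by right.
  case: (@three_colors_disconnected A _ _ _ neq0 neq1 _ A_gt1); first by rewrite eq_sym.
  by split; apply: conn.
by rewrite /other /= xA yA neq_xy /= => /negbFE/eqP; left.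
Qed.

End GallaiPartition.

(** * Colorings of bounded degree *)

(** Each of the five points has four others, hence exactly two related and two unrelated ones; a
    2-regular graph on five points is a 5-cycle, and so is its complement. The proof enumerates the
    ten truth values. *)
Lemma pentagon_relation (T : eqType) (r : rel T) (s : seq T) :
    symmetric r -> uniq s -> size s = 5 ->
    {in s, forall x, count (fun y => (y != x) && r x y) s <= 2} ->
    {in s, forall x, count (fun y => (y != x) && ~~ r x y) s <= 2} ->
  exists a b c d e, [/\ perm_eq s [:: a; b; c; d; e],
    [/\ r a b, r b c, r c d, r d e & r e a] &
    [/\ ~~ r a c, ~~ r b d, ~~ r c e, ~~ r d a & ~~ r e b]].
Proof.
move=> r_sym; case: s => [|a [|b [|c [|d [|e []]]]]] //= + _.
rewrite !inE !negb_or !andbT.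
case/and4P => /and4P[ab ac ad ae] /and3P[bc bd be] /andP[cd ce] de le_r le_nr.
have E x : x \in [:: a; b; c; d; e] ->
    ((x != a) && r x a + ((x != b) && r x b + ((x != c) && r x c +
      ((x != d) && r x d + ((x != e) && r x e + 0)))) <= 2) &&
    ((x != a) && ~~ r x a + ((x != b) && ~~ r x b + ((x != c) && ~~ r x c +
      ((x != d) && ~~ r x d + ((x != e) && ~~ r x e + 0)))) <= 2).
  by move=> xs; rewrite ![x == _]eq_sym (le_r x xs) (le_nr x xs).
have := E e; have := E d; have := E c; have := E b; have := E a.
rewrite !inE !eqxx ?orbT /= => /(_ isT) + /(_ isT) + /(_ isT) + /(_ isT) + /(_ isT).
rewrite (eq_sym b a) (eq_sym c a) (eq_sym d a) (eq_sym e a) (eq_sym c b).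
rewrite (eq_sym d b) (eq_sym e b) (eq_sym d c) (eq_sym e c) (eq_sym e d).
rewrite ab ac ad ae bc bd be cd ce de /=.
pose symE := (r_sym b a, r_sym c a, r_sym d a, r_sym e a, r_sym c b,
              r_sym d b, r_sym e b, r_sym d c, r_sym e c, r_sym e d).
rewrite !symE.
case rab: (r a b); case rac: (r a c); case rad: (r a d); case rae: (r a e) => //= _;
case rbc: (r b c); case rbd: (r b d); case rbe: (r b e) => //= _;
case rcd: (r c d); case rce: (r c e) => //= _; case rde: (r d e) => //= _ _;
let t x y z w := (exists a, x, y, z, w; rewrite ?symE
   ?(rab, rac, rad, rae, rbc, rbd, rbe, rcd, rce, rde); split=> //;
   apply/permP => P /=;
   move: (P a : nat) (P b : nat) (P c : nat) (P d : nat) (P e : nat); clear; lia) in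
(* With [a] in first place, these are the twelve cyclic orders of five points up to reversal. *)
first [t b c d e | t b c e d | t b d c e | t b d e c | t b e c d | t b e d c
      | t c b d e | t c b e d | t c d b e | t c e b d | t d b c e | t d c b e].
Qed.

Section BoundedDegree.

Variables (V : finType) (K : eqType) (col : V -> V -> K) (D : nat).
Hypothesis colC : forall x y, col x y = col y x.
Hypothesis col_free : triangle_rainbow_free col.
Hypothesis col_deg : forall x a, #|[set y | (y != x) && (col x y == a)]| <= D.

Lemma card_fibers (T : finType) (f : V -> T) (P : pred T) :
  #|[set y | P (f y)]| =
    \sum_(l <- enum (f @: [set: V]) | P l) #|[set y | f y == l]|.
Proof.
rewrite big_enum_cond /= -sum1_card.
rewrite (partition_big f (fun l => (l \in f @: [set: V]) && P l)) => /=; last first.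
  by move=> y; rewrite inE => ->; rewrite imset_f.
apply: eq_bigr => l /andP[_ Pl]; rewrite -sum1_card; apply: eq_bigl => y.
by rewrite !inE andbC; case: eqP => // ->.
Qed.

(** The parts of a Gallai partition, weighted by their sizes, form a reduced 2-colored complete
    graph. A vertex sees at most 2D vertices outside its part, so a part has at least N - 2D > D/3
    vertices and three parts exceed D. Labels are taken modulo 5, with [ordS] as the cyclic
    successor. *)
Lemma pentagonal_structure :
    0 < D -> 7 * D < 3 * #|V| ->
  exists (p : V -> 'I_5) (R B : K),
    [/\ R != B, forall i, exists x, p x = i,
        forall x y, p y = ordS (p x) -> col x y = R &
        forall x y, p y = ordS (ordS (p x)) -> col x y = B].
Proof.
move=> D_gt0 ltDV.
have V_gt1 : 1 < #|[set: V]| by rewrite cardsT; lia.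
have [f [R [B [_ fK [x0 [y0 [_ _ neq_f0]]] fcol]]]] :=
  gallai_partition_in colC col_free V_gt1.
have {}fK x : f (f x) = f x by apply: fK.
have {}fcol x y : f x != f y -> col x y = col (f x) (f y) /\ (col x y = R \/ col x y = B).
  by apply: fcol.
pose s := enum (f @: [set: V]); have [w wE] : exists w, forall l, #|[set y | f y == l]| = w l.
  by exists (fun l => #|[set y | f y == l]|).
have sP l : l \in s -> f l = l by rewrite mem_enum => /imsetP[x _ ->].
have fs x : f x \in s by rewrite mem_enum imset_f.
pose r x y := col x y == R.
have r_sym : symmetric r by move=> x y; rewrite /r colC.
(* All vertices of the parts joined to the part of [l] in one color are neighbors of the vertex [l]
   in that color; [b] selects [R] or [B]. *)
have wDb (b : bool) l : l \in s -> \sum_(y <- s | (y != l) && (r l y == b)) w y <= D.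
  move=> ls; rewrite -(eq_bigr _ (fun y _ => wE y)).
  rewrite -(card_fibers f (fun y => (y != l) && (r l y == b))).
  apply: leq_trans (col_deg l (if b then R else B)); apply/subset_leq_card/subsetP => y.
  rewrite !inE => /andP[neq_fyl]; have fl := sP l ls.
  have neq_fly : f l != f y by rewrite fl eq_sym.
  have [] := fcol l y neq_fly; rewrite fl /r => <- RB rb.
  have -> /= : y != l by apply: contraNneq neq_fyl => ->; rewrite fl.
  by case: b rb => /eqP // /eqP rb; case: RB => // ->; rewrite ?eqxx // => /eqP.
have wD l : l \in s -> \sum_(y <- s | (y != l) && r l y) w y <= D /\
                       \sum_(y <- s | (y != l) && ~~ r l y) w y <= D.
  by move=> ls; split; [have := wDb true l ls | have := wDb false l ls];
     under eq_bigl do rewrite ?eqb_id ?eqbF_neg.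
have sumW : \sum_(y <- s) w y = #|V|.
  rewrite -(eq_bigr _ (fun y _ => wE y)) -(card_fibers f predT) -cardsT.
  by apply: eq_card => y; rewrite !inE.
move: (#|V|) ltDV sumW => N ltDN sumW.
have s_uniq : uniq s := enum_uniq _.
have wL l : l \in s -> N <= w l + D + D.
  move=> ls; rewrite -sumW (bigD1_seq l) //= (bigID (r l)) /=.
  by have [leR leB] := wD l ls; rewrite -addnA leq_add2l leq_add.
have count_le2 (P : pred V) : \sum_(y <- s | P y) w y <= D -> count P s <= 2.
  move=> leD; rewrite leqNgt; apply/negP => gt2.
  suff leW : count P s * (N - 2 * D) <= \sum_(y <- s | P y) w y.
    have := leq_trans (leq_trans (leq_mul gt2 (leqnn _)) leW) leD; lia.
  rewrite -sum1_count big_distrl /= big_seq_cond [leqRHS]big_seq_cond.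
  by apply: leq_sum => y /andP[/wL leV _]; rewrite mul1n leq_subLR mul2n -addnn addnC addnA.
have s_gt1 : 1 < size s.
  rewrite -cardE; apply/card_gt1P; exists (f x0), (f y0).
  by rewrite !imset_f.
have s_le5 : size s <= 5.
  have [l ls] : exists l, l \in s by exists (f x0).
  have [/count_le2 leR /count_le2 leB] := wD l ls.
  have <- := count_predC (pred1 l) s; rewrite count_uniq_mem // ls.
  have : count (predC (pred1 l)) s <= count (fun y => (y != l) && r l y) s +
                                      count (fun y => (y != l) && ~~ r l y) s.
    rewrite -count_predUI; apply: leq_trans (leq_addr _ _).
    by apply: sub_count => y /= ->; case: (r l y).
  by move=> leC; apply: (leq_add (leqnn 1) (leq_trans leC (leq_add leR leB))).
have s_eq5 : size s = 5.
  (* For two, three or four parts, each 2-coloring of the reduced graph contradicts the degree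
     bounds by linear arithmetic. *)
  apply/eqP; rewrite eqn_leq s_le5 leqNgt; apply/negP => lt5.
  move: sumW wD s_uniq s_gt1 lt5; move: (s) => s'.
  case: s' => [|a [|b [|c [|d []]]]] //=.
  - rewrite !big_cons !big_nil !inE andbT => sumW wD ab _ _.
    have := wD a; have := wD b; rewrite !inE !eqxx ?orbT /=.
    rewrite !big_cons !big_nil !eqxx /= (eq_sym b a) ab /= (r_sym b a).
    by move=> /(_ isT) + /(_ isT); case: (r a b) => /=; lia.
  - rewrite !big_cons !big_nil !inE !negb_or !andbT => sumW wD /andP[/andP[ab ac] bc] _ _.
    have := wD a; have := wD b; have := wD c; rewrite !inE !eqxx ?orbT /=.
    rewrite !big_cons !big_nil !eqxx /= (eq_sym b a) (eq_sym c a) (eq_sym c b).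
    rewrite ab ac bc /= (r_sym b a) (r_sym c a) (r_sym c b).
    move=> /(_ isT) + /(_ isT) + /(_ isT).
    move: (r a b) (r a c) (r b c); clear - ltDN sumW.
    by case=> [] [] [] /=; lia.
  - rewrite !big_cons !big_nil !inE !negb_or !andbT.
    move=> sumW wD /and3P[/and3P[ab ac ad] /andP[bc bd] cd] _ _.
    have := wD a; have := wD b; have := wD c; have := wD d.
    rewrite !inE !eqxx ?orbT /= !big_cons !big_nil !eqxx /=.
    rewrite (eq_sym b a) (eq_sym c a) (eq_sym c b) (eq_sym d a) (eq_sym d b) (eq_sym d c).
    rewrite ab ac ad bc bd cd /=.
    rewrite (r_sym b a) (r_sym c a) (r_sym c b) (r_sym d a) (r_sym d b) (r_sym d c).
    move=> /(_ isT) + /(_ isT) + /(_ isT) + /(_ isT).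
    move: (r a b) (r a c) (r b c) (r a d) (r b d) (r c d); clear - ltDN sumW.
    by case=> [] [] [] [] [] [] /=; lia.
have [a [b [c [d [e [s_perm r_red r_blue]]]]]] := pentagon_relation r_sym s_uniq s_eq5
   (fun l ls => count_le2 _ (proj1 (wD l ls))) (fun l ls => count_le2 _ (proj2 (wD l ls))).
(* The representatives in the cyclic order of the [R]-pentagon; the label of a vertex is the
   position of its representative. *)
pose t := [:: a; b; c; d; e].
have t_uniq : uniq t by rewrite -(perm_uniq s_perm).
have ft x : f x \in t by rewrite -(perm_mem s_perm).
have idx_lt x : index (f x) t < 5 by rewrite (index_mem _ t).
pose p x := Ordinal (idx_lt x).
have colp x y : p x != p y ->
    col x y = col (nth a t (p x)) (nth a t (p y)) /\ (~~ r x y -> col x y = B).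
  move=> neq_p; rewrite !nth_index //.
  have /fcol[colxy RB] : f x != f y.
    by apply: contraNneq neq_p => eq_f; apply/eqP/val_inj; rewrite /= eq_f.
  by split=> //; rewrite /r; case: RB => // ->; rewrite eqxx.
have tf l : l \in t -> f l = l by rewrite -(perm_mem s_perm); apply: sP.
have pn i : i < 5 -> p (nth a t i) = i :> nat.
  move=> lt_i; rewrite -[LHS]/(index (f (nth a t i)) t) tf ?mem_nth //.
  by rewrite index_uniq.
have p_surj i : exists x, p x = i.
  by exists (nth a t i); apply: val_inj; apply: pn.
have ordS_neq (i : 'I_5) : i != ordS i by case: i => [[|[|[|[|[]]]]]].
have ordSS_neq (i : 'I_5) : i != ordS (ordS i) by case: i => [[|[|[|[|[]]]]]].
have red x y : p y = ordS (p x) -> col x y = R.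
  move=> p_y; have [| -> _] := colp x y; first by rewrite p_y ordS_neq.
  rewrite p_y; have [ab bc cd de ea] := r_red; apply/eqP.
  by case: (p x) => [[|[|[|[|[]]]]]].
have blue x y : p y = ordS (ordS (p x)) -> col x y = B.
  move=> p_y; have [| colxy] := colp x y; first by rewrite p_y ordSS_neq.
  apply; rewrite /r colxy p_y; have [ac bd ce da eb] := r_blue.
  by case: (p x) => [[|[|[|[|[]]]]]].
exists p, R, B; split=> //.
(* Parts 0 and 2 are not joined in [R], which separates the two colors. *)
have [x px] := p_surj ord0; have [y py] := p_surj (ordS (ordS ord0)).
have [|colxy _] := colp x y; first by rewrite px py.
rewrite -(blue x y) ?px ?py // colxy px py /=.
by case: r_blue; rewrite eq_sym.
Qed.

End BoundedDegree.

(** * Copies of triangles and stars *)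

Lemma imset_set2 (aT rT : finType) (f : aT -> rT) x y :
  f @: [set x; y] = [set f x; f y].
Proof. by rewrite imsetU1 imset_set1. Qed.

Lemma mem_edges (G : sgraph) (x y : G) : adj x y -> [set x; y] \in edges G.
Proof. by move=> xy; apply: (imset_f _ (x := (x, y))); rewrite inE. Qed.

Lemma edgesP (G : sgraph) (e : {set G}) :
  reflect (exists x y, adj x y /\ e = [set x; y]) (e \in edges G).
Proof.
apply: (iffP imsetP) => [[[x y] xy ->]|[x [y [xy ->]]]].
  by exists x, y; split=> //; rewrite inE in xy.
by exists (x, y); rewrite ?inE.
Qed.

(** A coloring of [G'] is pulled back along [g], and the copy found in [G] is pushed forward. *)
Lemma gallai_ramsey_prop_sub k (H G G' : sgraph) (g : G -> G') :
  is_copy g -> gallai_ramsey_prop k H G -> gallai_ramsey_prop k H G'.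
Proof.
move=> [inj_g adj_g] propG c.
have comp (F : sgraph) (f : F -> G) : is_copy f -> is_copy (g \o f).
  by case=> inj_f adj_f; split=> [|x y /adj_f/adj_g //]; apply: inj_comp.
case: (propG (fun e => c (g @: e))) => -[f [f_copy f_col]]; [left|right];
  exists (g \o f); split; [exact: comp| |exact: comp|].
  by move=> e e' eE e'E; rewrite (imset_comp g f e) (imset_comp g f e'); apply: f_col.
by move=> e e' eE e'E; rewrite (imset_comp g f e) (imset_comp g f e'); apply: f_col.
Qed.

(** The choice of the ordered pair is immaterial for symmetric [col]; [a0] is a default for sets
    that are not of the form {x, y}. *)
Definition pair_coloring k (G : sgraph) (a0 : 'I_k) (col : G -> G -> 'I_k) :
    edge_coloring k G :=
  fun e => if [pick p | e == [set p.1; p.2]] is Some p then col p.1 p.2 else a0.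

Lemma pair_coloringE k (G : sgraph) a0 (col : G -> G -> 'I_k) x y :
  (forall x y, col x y = col y x) -> pair_coloring a0 col [set x; y] = col x y.
Proof.
move=> colC; rewrite /pair_coloring; case: pickP => [[u v] /= /eqP/setP eq_e|].
  have /esym := eq_e x; have /esym := eq_e y; have := eq_e u; have := eq_e v.
  rewrite !inE !eqxx ?orTb ?orbT => v_xy u_xy; have {v_xy u_xy} := (v_xy, u_xy).
  case=> /orP[]/eqP-> /orP[]/eqP-> //; rewrite !orbb => yx xy.
    by rewrite (eqP yx).
  by rewrite (eqP xy).
by move/(_ (x, y)); rewrite eqxx.
Qed.

Section Translation.

Variables (k : nat) (G : sgraph) (c : edge_coloring k G).

Lemma has_rainbow_triangleP :
  has_rainbow_copy (complete 3) c <->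
  exists x y z : G, [/\ adj x y, adj y z, adj x z &
    uniq [:: c [set x; y]; c [set y; z]; c [set x; z]]].
Proof.
split=> [[f [[_ adj_f] inj_c]]|[x [y [z [xy yz xz]]]]].
  have adj3 (i j : 'I_3) : i != j -> @adj (complete 3) i j by [].
  pose o1 : 'I_3 := Ordinal (isT : 1 < 3).
  exists (f ord0), (f o1), (f ord_max); split; try exact: adj_f.
  rewrite -!imset_set2 /= !inE negb_or !andbT.
  (* Two edges of the triangle are told apart by a vertex [l] on exactly one of them. *)
  have neq_c (i j i' j' l : 'I_3) : i != j -> i' != j' ->
      (l \in [set i; j]) != (l \in [set i'; j']) ->
      c (f @: [set i; j]) != c (f @: [set i'; j']).
    move=> ij ij' neq_l; apply: contraNneq neq_l => eq_c.
    by rewrite (inj_c _ _ _ _ eq_c) //; apply: mem_edges.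
  apply/andP; split; [apply/andP; split|].
  - by apply: (@neq_c _ _ _ _ ord0); rewrite // !inE.
  - by apply: (@neq_c _ _ _ _ o1); rewrite // !inE.
  - by apply: (@neq_c _ _ _ _ ord0); rewrite // !inE.
rewrite /= !inE negb_or andbT => /andP[/andP[neq1 neq2] neq3].
pose o1 : 'I_3 := Ordinal (isT : 1 < 3).
pose f (i : complete 3) : G := nth x [:: x; y; z] i.
have ord3 (i : 'I_3) : [\/ i = ord0, i = o1 | i = ord_max].
  case: i => [[|[|[|//]]] lt_i]; [constructor 1 | constructor 2 | constructor 3];
  exact: val_inj.
have adj_f (i j : 'I_3) : i != j -> adj (f i) (f j).
  by have [] := ord3 i => ->; have [] := ord3 j => -> // _; rewrite /f /= // adj_sym.
exists f; split; first split => // i j eq_f.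
  by apply/eqP; apply: contraTT isT => /adj_f; rewrite eq_f adj_irrefl.
have edge3 (e : {set complete 3}) : e \in edges (complete 3) ->
    [\/ e = [set ord0; o1], e = [set o1; ord_max] | e = [set ord0; ord_max]].
  move=> /edgesP[i [j [+ ->]]]; have [] := ord3 i => ->; have [] := ord3 j => -> // _;
  let t := first [by constructor 1 | by constructor 2 | by constructor 3] in
  first [t | rewrite setUC; t].
move=> e e' /edge3 eE /edge3 e'E; case: eE => ->; case: e'E => -> //;
rewrite !imset_set2 /f /= => /eqP; rewrite ?(negPf neq1) ?(negPf neq2) ?(negPf neq3) //.
all: by rewrite eq_sym ?(negPf neq1) ?(negPf neq2) ?(negPf neq3).
Qed.

Lemma has_mono_starP m :
  0 < m -> has_mono_copy (star m) c <->
  exists x a, m <= #|[set y | adj x y && (c [set x; y] == a)]|.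
Proof.
move=> m_gt0; split=> [[f [[inj_f adj_f] mono_f]]|[x [a le_m]]].
  pose y i := f (Some i); have xy i : @adj (star m) None (Some i) by [].
  exists (f None), (c [set f None; y (Ordinal m_gt0)]).
  have inj_y : injective y by move=> i j /inj_f[].
  rewrite -[X in X <= _]card_ord -cardsT -(card_imset _ inj_y).
  apply/subset_leq_card/subsetP => _ /imsetP[i _ ->].
  rewrite inE adj_f //= -!imset_set2; apply/eqP.
  by apply: mono_f; apply: mem_edges.
set S := [set y | _] in le_m.
pose f (i : star m) : G := if i is Some j then enum_val (widen_ord le_m j) else x.
have fS j : f (Some j) \in S by apply: enum_valP.
have adj_xf j : adj x (f (Some j)) by have := fS j; rewrite inE => /andP[].
exists f; split; first split.
- case=> [i|] [j|] //.
  + by move/enum_val_inj => /(congr1 val) /= /val_inj->.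
  + by move=> eq_f; have := adj_xf i; rewrite eq_f /= adj_irrefl.
  + by move=> eq_f; have := adj_xf j; rewrite -eq_f /= adj_irrefl.
- by case=> [i|] [j|] //= _; [rewrite adj_sym|]; apply: (adj_xf).
suff mono e : e \in edges (star m) -> c (f @: e) = a.
  by move=> e e' /mono-> /mono->.
case/edgesP=> -[i|] [[j|] [//= _ ->]]; rewrite imset_set2 ?[[set f (Some _); _]]setUC.
  by have := fS i; rewrite inE => /andP[_ /eqP].
by have := fS j; rewrite inE => /andP[_ /eqP].
Qed.

End Translation.

(** Replaces colorings of edge sets by symmetric functions of two vertices, and monochromatic stars
    by color degrees; the bounds are all proved in this form. *)
Lemma gallai_ramsey_starP k m (G : sgraph) :
    0 < k -> 0 < m ->
  gallai_ramsey_prop k (star m) G <->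
  forall col : G -> G -> 'I_k, (forall x y, col x y = col y x) ->
    (exists x y z, [/\ adj x y, adj y z, adj x z &
       uniq [:: col x y; col y z; col x z]]) \/
    (exists x a, m <= #|[set y | adj x y && (col x y == a)]|).
Proof.
move=> k_gt0 m_gt0; split=> [propG col colC|propG c].
  pose c := pair_coloring (Ordinal k_gt0) col.
  have cE x y : c [set x; y] = col x y by apply: pair_coloringE.
  case: (propG c) => [/has_rainbow_triangleP|/(has_mono_starP c m_gt0)].
    by case=> x [y [z]]; rewrite !cE => ?; left; exists x, y, z.
  case=> x [a]; under eq_finset do rewrite cE.
  by move=> ?; right; exists x, a.
have cC (x y : G) : c [set x; y] = c [set y; x] by rewrite setUC.
case: (propG (fun x y => c [set x; y]) cC) => [?|?].
  by left; apply/has_rainbow_triangleP.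
by right; apply/has_mono_starP.
Qed.

(** * Adding a vertex to a blown-up pentagon *)

Lemma iter_ordS_inj (i : 'I_5) : injective (fun j : 'I_5 => iter j (@ordS 5) i).
Proof.
move=> j j' /(congr1 val) eq_ij; apply: val_inj; move: eq_ij.
by case: i j j' => [[|[|[|[|[|//]]]]] ?] [[|[|[|[|[|//]]]]] ?] [[|[|[|[|[|//]]]]] ?].
Qed.

Lemma iter5_ordS (i : 'I_5) : iter 5 (@ordS 5) i = i.
Proof. by apply: val_inj; case: i => [[|[|[|[|[|//]]]]] ?]. Qed.

(* A coloring of the complete graph on [V] together with a vertex [v] outside
   [V] that is joined to every [x \in S] by an edge of color [vcol x]. *)
Section Extension.

Variables (V : finType) (K : eqType) (col : V -> V -> K) (D : nat).
Variables (S : {set V}) (vcol : V -> K).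
Hypothesis colC : forall x y, col x y = col y x.
Hypothesis vcol_free : forall x y, x \in S -> y \in S -> x != y ->
  [|| vcol x == vcol y, vcol x == col x y | vcol y == col x y].
Hypothesis col_deg : forall x a,
  #|[set y | (y != x) && (col x y == a)]| + ((x \in S) && (vcol x == a)) <= D.
Hypothesis vcol_deg : forall a, #|[set x in S | vcol x == a]| <= D.

Lemma mono_nbr_card x a (E : {set V}) :
    x \notin E -> {in E, forall y, col x y = a} ->
  #|E| + ((x \in S) && (vcol x == a)) <= D.
Proof.
move=> xE Ea; apply: leq_trans (col_deg x a); rewrite leq_add2r.
apply/subset_leq_card/subsetP => y yE; rewrite inE Ea // eqxx andbT.
by apply: contraNneq xE => <-.
Qed.

Section Parts.

Variables (p : V -> 'I_5) (R B : K).
Hypothesis neqRB : R != B.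
Hypothesis p_surj : forall i, exists x, p x = i.
Hypothesis pR : forall x y, p y = ordS (p x) -> col x y = R.
Hypothesis pB : forall x y, p y = ordS (ordS (p x)) -> col x y = B.

(** The class [j] steps after class [i] on the pentagon; [j] is a natural number read modulo 5, so
    any class can be moved to position 0. *)
Definition part (i : 'I_5) j := [set x | p x == iter j (@ordS 5) i].

Lemma in_part i j x : (x \in part i j) = (p x == iter j (@ordS 5) i).
Proof. by rewrite inE. Qed.

Lemma part_disjoint i j j' : j < 5 -> j' < 5 -> j != j' -> [disjoint part i j & part i j'].
Proof.
move=> ltj ltj' neq_j; rewrite -setI_eq0; apply/eqP/setP => x; rewrite !inE.
apply: contraNF neq_j => /andP[/eqP-> /eqP].
by move/(@iter_ordS_inj i (Ordinal ltj) (Ordinal ltj'))/(congr1 val)=> /= ->.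
Qed.

Lemma part_col_red i j x y :
  x \in part i j -> y \in part i j.+1 -> col x y = R /\ col y x = R.
Proof. by rewrite !inE [col y x]colC => /eqP px /eqP py; rewrite pR // py px. Qed.

Lemma part_col_blue i j x y :
  x \in part i j -> y \in part i j.+2 -> col x y = B /\ col y x = B.
Proof. by rewrite !inE [col y x]colC => /eqP px /eqP py; rewrite pB // py px. Qed.

Lemma part_mod i j : part i (j + 5) = part i j.
Proof. by apply/setP => x; rewrite !inE iterD iter5_ordS. Qed.

Lemma card_parts i :
  #|part i 0| + #|part i 1| + #|part i 2| + #|part i 3| + #|part i 4| = #|V|.
Proof.
rewrite -[RHS]cardsT -[RHS]sum1_card (partition_big p predT) //=.
rewrite (reindex_inj (@iter_ordS_inj i)) /= !big_ord_recl big_ord0 /= addn0 !addnA.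
by rewrite -!sum1_card; do !congr (_ + _); apply: eq_bigl => x; rewrite !inE.
Qed.

Lemma card_part2U i (E : {set V}) j j' :
    0 < j < 5 -> 0 < j' < 5 -> j != j' -> E \subset part i 0 ->
  #|part i j :|: part i j' :|: E| = #|part i j| + #|part i j'| + #|E|.
Proof.
move=> /andP[j_gt0 ltj] /andP[j'_gt0 ltj'] neq_j sE.
have disj l : 0 < l -> l < 5 -> part i l :&: E = set0.
  move=> l_gt0 ltl; apply/eqP; rewrite setI_eq0.
  by apply: disjointWr sE (part_disjoint _ _ _ _); rewrite // -lt0n.
have /eqP disj2 : part i j :&: part i j' == set0 by rewrite setI_eq0 part_disjoint.
by rewrite !cardsU setIUl !disj // disj2 setU0 !cards0 !subn0.
Qed.

(** The two classes joined to [x] in a color, the set [E] inside the class of [x], and possibly [v]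
    are disjoint contributions to one color degree of [x]. *)
Lemma part_saturation i x (E : {set V}) :
    x \in part i 0 -> x \notin E -> E \subset part i 0 ->
  ({in E, forall y, col x y = R} ->
    #|part i 1| + #|part i 4| + #|E| + ((x \in S) && (vcol x == R)) <= D) /\
  ({in E, forall y, col x y = B} ->
    #|part i 2| + #|part i 3| + #|E| + ((x \in S) && (vcol x == B)) <= D).
Proof.
(* Viewing class 0 also as class 5 makes classes 3 and 4 its predecessors. *)
move=> x0 xE sE; have x5 : x \in part i 5 by rewrite (part_mod i 0).
have xN j : 0 < j -> j < 5 -> x \notin part i j.
  move=> j_gt0 j_lt5; rewrite (disjointFr (@part_disjoint i 0 j _ _ _) x0) //.
  by rewrite eq_sym -lt0n.
split=> Ea; rewrite -card_part2U //; apply: mono_nbr_card.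
- by rewrite !in_setU !negb_or !xN.
- move=> y /setUP[/setUP[y1|y4]|]; last exact: Ea.
    by have [] := part_col_red x0 y1.
  by have [] := part_col_red y4 x5.
- by rewrite !in_setU !negb_or !xN.
- move=> y /setUP[/setUP[y2|y3]|]; last exact: Ea.
    by have [] := part_col_blue x0 y2.
  by have [] := part_col_blue y3 x5.
Qed.

Lemma part_shift i j l : part (iter j (@ordS 5) i) l = part i (l + j).
Proof. by apply/setP => x; rewrite !inE iterD. Qed.

Lemma part_saturation_shift i j x :
    x \in part i j ->
  #|part i (1 + j)| + #|part i (4 + j)| + ((x \in S) && (vcol x == R)) <= D /\
  #|part i (2 + j)| + #|part i (3 + j)| + ((x \in S) && (vcol x == B)) <= D.
Proof.
rewrite -[j]add0n -part_shift => x0.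
have [] := part_saturation x0 (negbT (in_set0 x)) (sub0set _).
rewrite !part_shift cards0 !addn0 add0n => redD blueD.
by split; [apply: redD | apply: blueD] => y; rewrite inE.
Qed.

(** Two consecutive classes are the [B]-neighbors of the class opposite them; two classes at
    distance two are the [R]-neighbors of the class between them. *)
Lemma part_pairs i (A := fun j => #|part i j|) :
  [/\ A 0 + A 1 <= D, A 0 + A 2 <= D, A 0 + A 3 <= D & A 0 + A 4 <= D] /\
  [/\ A 1 + A 2 <= D, A 1 + A 3 <= D, A 1 + A 4 <= D & A 2 + A 3 <= D] /\
  (A 2 + A 4 <= D /\ A 3 + A 4 <= D).
Proof.
have sat j : #|part i (1 + j)| + #|part i (4 + j)| <= D /\
             #|part i (2 + j)| + #|part i (3 + j)| <= D.
  have [x px] := p_surj (iter j (@ordS 5) i).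
  have xj : x \in part i j by rewrite in_part px.
  by have [r b] := part_saturation_shift xj; split;
    [move: r | move: b]; apply: leq_trans (leq_addr _ _).
have [] := sat 0; have [] := sat 1; have [] := sat 2; have [] := sat 3; have [] := sat 4.
rewrite !addnS !addn0 -[6]/(1 + 5) -[7]/(2 + 5) -[8]/(3 + 5) -[5]/(0 + 5) !part_mod.
by rewrite /A => *; split; [split | split; [split | split]]; lia.
Qed.

Lemma iter_ordS_onto (i i' : 'I_5) : exists j : 'I_5, i' = iter j (@ordS 5) i.
Proof.
by have [g _ gK] := injF_bij (@iter_ordS_inj i); exists (g i'); rewrite gK.
Qed.

Lemma col_RB x y : p x != p y -> col x y = R \/ col x y = B.
Proof.
move=> neq_p; have [j py] := iter_ordS_onto (p x) (p y).
have x0 : x \in part (p x) 0 by rewrite in_part.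
have x5 : x \in part (p x) 5 by rewrite (part_mod (p x) 0).
have yj : y \in part (p x) j by rewrite in_part -py.
case: j py yj => [[|[|[|[|[|//]]]]] ?] /= py yj.
- by rewrite py eqxx in neq_p.
- by left; have [] := part_col_red x0 yj.
- by right; have [] := part_col_blue x0 yj.
- by right; have [] := part_col_blue yj x5.
- by left; have [] := part_col_red yj x5.
Qed.

(** Any two classes have at most 2h vertices together and all five have 5h, so each has h. Every
    vertex is then saturated in [R] and [B], so v uses neither, and triangles through v force one
    color on all its 2h + 1 edges. *)
Lemma odd_extension_false h :
  0 < h -> D = 2 * h -> #|V| = 5 * h -> #|S| = 2 * h + 1 -> False.
Proof.
move=> h_gt0 defD cardV cardS.
have cardA i : [/\ #|part i 0| = h, #|part i 1| = h, #|part i 2| = h, #|part i 3| = h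
                 & #|part i 4| = h].
  have /= [[? ? ? ?] [[? ? ? ?] [? ?]]] := part_pairs i; have := card_parts i.
  by rewrite cardV; split; lia.
have vcolN x : x \in S -> vcol x != R /\ vcol x != B.
  move=> xS; have x0 : x \in part (p x) 0 by rewrite in_part.
  have [] := part_saturation_shift x0; have [_ -> -> -> ->] := cardA (p x).
  by rewrite xS; do 2 case: eqP => _; lia.
have vcolE x y : x \in S -> y \in S -> p x != p y -> vcol x = vcol y.
  move=> xS yS neq_p; have [nRx nBx] := vcolN x xS; have [nRy nBy] := vcolN y yS.
  have neq_xy : x != y by apply: contraNneq neq_p => ->.
  have := vcol_free xS yS neq_xy.
  have [] := col_RB neq_p => ->; first by rewrite (negPf nRx) (negPf nRy) !orbF => /eqP.
  by rewrite (negPf nBx) (negPf nBy) !orbF => /eqP.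
have [x xS] : exists x, x \in S by apply/set0Pn; rewrite -card_gt0 cardS addn1.
have [y yS neq_xy] : exists2 y, y \in S & p x != p y.
  have /subsetPn[y yS] : ~~ (S \subset part (p x) 0).
    apply/negP => /subset_leq_card; have [-> _ _ _ _] := cardA (p x); lia.
  by rewrite in_part eq_sym; exists y.
have := vcol_deg (vcol x); suff -> : [set z in S | vcol z == vcol x] = S by lia.
apply/setP => z; rewrite inE andb_idr // => zS; apply/eqP.
(* A vertex in the class of [x] is compared with [x] through [y]. *)
have [eq_xz|neq_xz] := eqVneq (p x) (p z); last by apply/esym/vcolE.
by rewrite (vcolE x y) // (vcolE z y) // -eq_xz.
Qed.

(** Classes 1 and 4 are saturated in [R], classes 2 and 3 in [B], since the large class 0 is among
    their neighbors in that color. The triangles of v over the pairs 12, 13, 24 and 34 then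
    propagate: [vcol x2 = R] determines all four colors, and otherwise the four agree. *)
Lemma even_vcol_chain i h (A := fun j => S :&: part i j) :
    D + 1 = 2 * h -> #|part i 0| = h ->
    [/\ #|part i 1| + 1 = h, #|part i 2| + 1 = h, #|part i 3| + 1 = h & #|part i 4| + 1 = h] ->
  forall x1 x2 x3 x4, x1 \in A 1 -> x2 \in A 2 -> x3 \in A 3 -> x4 \in A 4 ->
  [/\ vcol x1 = vcol x2, vcol x2 = vcol x3, vcol x3 = vcol x4, vcol x1 != R & vcol x2 != B] \/
  [/\ vcol x1 = B, vcol x2 = R, vcol x3 = R & vcol x4 = B].
Proof.
move=> defD card0 [card1 card2 card3 card4].
have slack a b (q : bool) : D <= a + b -> a + b + (true && q) <= D -> ~~ q.
  by clear; case: q => //=; lia.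
have [le20 le03 le40 le01] : [/\ D <= #|part i 2| + #|part i 0|, D <= #|part i 0| + #|part i 3|,
    D <= #|part i 4| + #|part i 0| & D <= #|part i 0| + #|part i 1|].
  by clear - defD card0 card1 card2 card3 card4; split; lia.
move=> x1 x2 x3 x4.
move=> /setIP[S1 P1] /setIP[S2 P2] /setIP[S3 P3] /setIP[S4 P4].
have cardM j : #|part i (j + 5)| = #|part i j| by rewrite part_mod.
have n1 : vcol x1 != R.
  have [+ _] := part_saturation_shift P1.
  by rewrite !addSn !add0n (cardM 0) S1; apply: slack.
have n2 : vcol x2 != B.
  have [_] := part_saturation_shift P2.
  by rewrite !addSn !add0n (cardM 0) S2; apply: slack.
have n3 : vcol x3 != B.
  have [_] := part_saturation_shift P3.
  by rewrite !addSn !add0n (cardM 0) (cardM 1) S3; apply: slack.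
have n4 : vcol x4 != R.
  have [+ _] := part_saturation_shift P4.
  by rewrite !addSn !add0n (cardM 0) (cardM 3) S4; apply: slack.
have neq j j' x y : j < 5 -> j' < 5 -> j != j' -> x \in part i j -> y \in part i j' -> x != y.
  move=> ltj ltj' neq_j xj yj'; apply: contraTneq xj => ->.
  by rewrite (disjointFl (part_disjoint i ltj ltj' neq_j) yj').
have := vcol_free S1 S2 (neq 1 2 _ _ isT isT isT P1 P2).
have := vcol_free S1 S3 (neq 1 3 _ _ isT isT isT P1 P3).
have := vcol_free S2 S4 (neq 2 4 _ _ isT isT isT P2 P4).
have := vcol_free S3 S4 (neq 3 4 _ _ isT isT isT P3 P4).
have [-> _] := part_col_red P1 P2; have [-> _] := part_col_blue P1 P3.
have [-> _] := part_col_blue P2 P4; have [-> _] := part_col_red P3 P4.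
rewrite (negPf n1) (negPf n2) (negPf n3) (negPf n4) /= !orbF => v34 v24 v13 v12.
have [v2|v2] := eqVneq (vcol x2) R.
  right; move: v24; rewrite v2 eq_sym (negPf n4) /= => /eqP v4.
  move: v34; rewrite v4 (negPf n3) /= => /eqP v3.
  by move: v13; rewrite v3 (negPf n1) /= => /eqP.
move: v12; rewrite (negPf v2) orbF => /eqP v12.
move: v13; rewrite v12 (negPf n2) orbF => /eqP v13.
by move: v34; rewrite -v13 (negPf v2) orbF => /eqP v34; left.
Qed.

(** Five classes of at most h - 1 vertices are too few, so one has at least h, and [part_pairs]
    forces the sizes h and four times h - 1. Of the two patterns in [even_vcol_chain], the first
    overloads v and the second overloads an end of an edge inside the large class. *)
Lemma even_extension_false h :
  5 < h -> D + 1 = 2 * h -> #|V| + 4 = 5 * h -> #|S| + 2 = 4 * h -> False.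
Proof.
move=> h_gt5 defD cardV cardS.
have [i le_h] : exists i, h <= #|part i 0|.
  case: (pickP (fun i => h <= #|part i 0|)) => [i|noi]; first by exists i.
  have lt j : #|part ord0 j| < h by rewrite -(part_shift _ j 0) ltnNge noi.
  have := card_parts ord0; have := lt 4; have := lt 3; have := lt 2; have := lt 1; have := lt 0.
  by clear - cardV h_gt5; lia.
have [card0 card1 card2 [card3 card4]] : [/\ #|part i 0| = h, #|part i 1| + 1 = h,
    #|part i 2| + 1 = h & #|part i 3| + 1 = h /\ #|part i 4| + 1 = h].
  have /= [[? ? ? ?] [[? ? ? ?] [? ?]]] := part_pairs i; have := card_parts i.
  by split; lia.
have chain := even_vcol_chain defD card0 (And4 card1 card2 card3 card4).
(* [S] misses only h - 2 vertices, too few to avoid a class of size h - 1. *)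
have meet j : #|part i j| + 1 = h -> exists x, x \in S :&: part i j.
  move=> cardj; apply/set0Pn; rewrite -card_gt0.
  by have := cardsUI S (part i j); have := max_card (S :|: part i j); lia.
have [r1 r1A] := meet 1 card1; have [r2 r2A] := meet 2 card2.
have [r3 r3A] := meet 3 card3; have [r4 r4A] := meet 4 card4.
have part_cases x : x \in S -> [\/ x \in part i 0,
    x \in S :&: part i 1 \/ x \in S :&: part i 4 | x \in S :&: part i 2 \/ x \in S :&: part i 3].
  move=> xS; have [j px] := iter_ordS_onto i (p x).
  have := in_part i j x; rewrite px eqxx !in_setI xS /=.
  by case: j {px} => [[|[|[|[|[|//]]]]] ?] /= xj;
     [constructor 1 | constructor 2; left | constructor 3; left
     | constructor 3; right | constructor 2; right].
case: (chain _ _ _ _ r1A r2A r3A r4A) => [[e12 e23 e34 n1 n2]|[v1 v2 v3 v4]].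
  (* First pattern: v has at least 3h - 2 > D edges to the small classes, all of one color. *)
  have same x : x \in S -> x \notin part i 0 -> vcol x = vcol r1.
    move=> xS x0; case: (part_cases x xS) => [|[xA|xA]|[xA|xA]]; first by rewrite (negPf x0).
    - case: (chain _ _ _ _ xA r2A r3A r4A) => [[-> _ _ _ _]|[_ w2 _ _]] //.
      by rewrite e12 w2 eqxx in n1.
    - case: (chain _ _ _ _ r1A r2A r3A xA) => [[_ _ <- _ _]|[w1 w2 _ _]].
        by rewrite -e23 -e12.
      by rewrite e12 w2 eqxx in n1.
    - case: (chain _ _ _ _ r1A xA r3A r4A) => [[<- _ _ _ _] //|[w1 _ _ _]].
      by rewrite -e12 w1 eqxx in n2.
    - case: (chain _ _ _ _ r1A r2A xA r4A) => [[_ <- _ _ _] //|[w1 _ _ _]].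
      by rewrite -e12 w1 eqxx in n2.
  have /subset_leq_card leS : S \subset [set x in S | vcol x == vcol r1] :|: part i 0.
    apply/subsetP => x xS; rewrite in_setU; have [//|x0] := boolP (x \in part i 0).
      by rewrite orbT.
    by rewrite inE xS same // eqxx.
  have := leq_trans leS (leq_card_setU _ _); have := vcol_deg (vcol r1).
  by clear - defD card0 cardS h_gt5; lia.
have blue x : x \in S :&: part i 1 \/ x \in S :&: part i 4 -> vcol x = B.
  case=> xA.
    case: (chain _ _ _ _ xA r2A r3A r4A) => [[_ _ e _ _]|[] //].
    by move: neqRB; rewrite -v3 -v4 e eqxx.
  case: (chain _ _ _ _ r1A r2A r3A xA) => [[e _ _ _ _]|[] //].
  by move: neqRB; rewrite -v1 -v2 e eqxx.
have red x : x \in S :&: part i 2 \/ x \in S :&: part i 3 -> vcol x = R.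
  case=> xA.
    case: (chain _ _ _ _ r1A xA r3A r4A) => [[_ _ e _ _]|[] //].
    by move: neqRB; rewrite -v3 -v4 e eqxx.
  case: (chain _ _ _ _ r1A r2A xA r4A) => [[e _ _ _ _]|[] //].
  by move: neqRB; rewrite -v1 -v2 e eqxx.
(* For [x] in class 0, the triangle of v, [x] and [r1] has a [B]-edge at v and an [R]-edge opposite
   v. *)
have two x : x \in S -> vcol x = R \/ vcol x = B.
  move=> xS; case: (part_cases x xS) => [x0|/blue|/red]; try by [left|right].
  have /setIP[r1S r1P] := r1A; have [xr1 _] := part_col_red x0 r1P.
  have neq : x != r1.
    by apply: contraTneq r1P => <-; rewrite (disjointFr (@part_disjoint i 0 1 _ _ _) x0).
  have := vcol_free xS r1S neq; rewrite v1 xr1 [B == R]eq_sym (negPf neqRB) orbF.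
  by case/orP=> /eqP; [right | left].
pose SR := [set x in S | vcol x == R]; pose SB := [set x in S | vcol x == B].
have /subset_leq_card leS : S \subset SR :|: SB.
  by apply/subsetP => x xS; rewrite !inE xS /=; case: (two x xS) => ->; rewrite eqxx ?orbT.
have {}leS := leq_trans leS (leq_card_setU _ _).
have [leR leB] : #|SR| <= D /\ #|SB| <= D by split; apply: vcol_deg.
have card23 : #|part i 2 :|: part i 3| <= #|part i 2| + #|part i 3| := leq_card_setU _ _.
have card14 : #|part i 1 :|: part i 4| <= #|part i 1| + #|part i 4| := leq_card_setU _ _.
(* As |S| = 2D, both colors occur exactly D times at v, whereas classes 2 and 3, like classes 1 and
   4, have only D - 1 vertices together. *)
have [x [xS x0 vx]] : exists x, [/\ x \in S, x \in part i 0 & vcol x = R].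
  have /subsetPn[x + xN] : ~~ (SR \subset part i 2 :|: part i 3).
    apply/negP => /subset_leq_card leSR.
    by clear - defD cardS leS leB leSR card2 card3 card23; lia.
  rewrite inE => /andP[xS /eqP vx]; exists x; split=> //.
  case: (part_cases x xS) => [//|/blue vB|[] /setIP[_ xA]].
  - by move: neqRB; rewrite -vx vB eqxx.
  - by rewrite in_setU xA in xN.
  - by rewrite in_setU xA orbT in xN.
have [y [yS y0 vy]] : exists y, [/\ y \in S, y \in part i 0 & vcol y = B].
  have /subsetPn[y + yN] : ~~ (SB \subset part i 1 :|: part i 4).
    apply/negP => /subset_leq_card leSB.
    by clear - defD cardS leS leR leSB card1 card4 card14; lia.
  rewrite inE => /andP[yS /eqP vy]; exists y; split=> //.
  case: (part_cases y yS) => [//|[] /setIP[_ yA]|/red vR].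
  - by rewrite in_setU yA in yN.
  - by rewrite in_setU yA orbT in yN.
  - by move: neqRB; rewrite -vy vR eqxx.
have neq_xy : x != y by apply: contraNneq neqRB => eq_xy; rewrite -vx -vy eq_xy.
have [sy sx] : [set y] \subset part i 0 /\ [set x] \subset part i 0 by rewrite !sub1set.
have nxy : x \notin [set y] by rewrite inE.
have [redx _] := part_saturation x0 nxy sy.
have nyx : y \notin [set x] by rewrite inE eq_sym.
have [_ bluey] := part_saturation y0 nyx sx.
(* The edge [x y] has color [R] or [B]; this gives [x] or [y], respectively, the degree (D - 1) + 2
   in that color. *)
have := vcol_free xS yS neq_xy; rewrite vx vy (negPf neqRB) /=.
case/orP=> /eqP xy.
  have := redx; rewrite xS vx eqxx cards1.
  suff Ey : {in [set y], forall z, col x z = R} by move/(_ Ey); clear - defD card1 card4; lia.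
  by move=> z /set1P->.
have := bluey; rewrite yS vy eqxx cards1.
suff Ex : {in [set x], forall z, col y z = B} by move/(_ Ex); clear - defD card2 card3; lia.
by move=> z /set1P->; rewrite colC.
Qed.

End Parts.
End Extension.

(** * Upper bounds *)

Lemma ord_some_inj N : injective (@Some 'I_N).
Proof. by move=> x y []. Qed.

(** A counterexample restricts to a coloring of K_N and the colors of the edges at [None], with [S]
    the first s vertices and all color degrees at most m - 1. *)
Lemma complete_star_prop k m N s :
    0 < k -> 0 < m -> s <= N ->
    (forall (col : 'I_N -> 'I_N -> 'I_k) (vcol : 'I_N -> 'I_k) (S : {set 'I_N}),
       (forall x y, col x y = col y x) -> triangle_rainbow_free col ->
       (forall x y, x \in S -> y \in S -> x != y ->
          [|| vcol x == vcol y, vcol x == col x y | vcol y == col x y]) ->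
       (forall x a, #|[set y | (y != x) && (col x y == a)]| +
          ((x \in S) && (vcol x == a)) <= m.-1) ->
       (forall a, #|[set x in S | vcol x == a]| <= m.-1) ->
       #|S| = s -> False) ->
  gallai_ramsey_prop k (star m) (complete_star N s).
Proof.
move=> k_gt0 m_gt0 le_sN noExt; apply/gallai_ramsey_starP => // col colC.
pose rainbow t := [&& complete_star_adj s t.1.1 t.1.2, complete_star_adj s t.1.2 t.2,
  complete_star_adj s t.1.1 t.2 & uniq [:: col t.1.1 t.1.2; col t.1.2 t.2; col t.1.1 t.2]].
case: (pickP rainbow) => [[[x y] z] /and4P[xy yz xz c_uniq]|norainbow].
  by left; exists x, y, z.
pose deg x a := #|[set y | complete_star_adj s x y && (col x y == a)]|.
case: (pickP (fun t => m <= deg t.1 t.2)) => [[x a] le_m|lowdeg].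
  by right; exists x, a.
have free x y z : @adj (complete_star N s) x y -> @adj (complete_star N s) y z ->
    @adj (complete_star N s) x z ->
    [|| col x y == col y z, col x y == col x z | col y z == col x z].
  move=> xy yz xz; have := norainbow (x, y, z); rewrite /rainbow /= in xy yz xz *.
  by rewrite xy yz xz /= !inE andbT negb_or => /negbT; rewrite !negb_and !negbK -orbA.
have degD x a : deg x a <= m.-1 by have := lowdeg (x, a); rewrite /=; lia.
exfalso; apply: (noExt (fun x y => col (Some x) (Some y)) (fun x => col None (Some x))
  [set x : 'I_N | x < s]).
- by move=> x y; apply: colC.
- by move=> x y z; apply: (free (Some x) (Some y) (Some z)).
- move=> x y; rewrite !inE => xS yS neq_xy.
  by rewrite (colC None (Some x)); apply: (free (Some x) None (Some y)).
- move=> x a; apply: leq_trans (degD (Some x) a).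
  rewrite /deg (cardsD1 None) addnC !inE /= (colC _ None) leq_add2l.
  rewrite -(card_imset _ (@ord_some_inj N)); apply/subset_leq_card/subsetP => _ /imsetP[y + ->].
  by rewrite !inE /= eq_sym.
- move=> a; apply: leq_trans (degD None a).
  rewrite -(card_imset _ (@ord_some_inj N)); apply/subset_leq_card/subsetP => _ /imsetP[y + ->].
  by rewrite !inE.
have inj_w : injective (widen_ord le_sN) by move=> i j /(congr1 val) /= /val_inj.
rewrite -[RHS]card_ord -[RHS]cardsT -(card_imset _ inj_w); apply: eq_card => x.
rewrite inE; apply/idP/imsetP => [lt_xs|[i _ ->]]; last exact: (ltn_ord i).
by exists (Ordinal lt_xs) => //; apply: val_inj.
Qed.

Lemma odd_star_upper k h : 0 < k -> 0 < h ->
  gallai_ramsey_prop k (star (2 * h + 1)) (complete_star (5 * h) (2 * h + 1)).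
Proof.
move=> k_gt0 h_gt0; apply: complete_star_prop => //; try lia.
rewrite addn1 /= => col vcol S colC free vfree deg vdeg cardS.
have deg0 x a : #|[set y | (y != x) && (col x y == a)]| <= 2 * h.
  exact: leq_trans (leq_addr _ _) (deg x a).
have [||p [R [B [neqRB p_surj pR pB]]]] := pentagonal_structure colC free deg0.
- by lia.
- by rewrite card_ord; lia.
apply: (odd_extension_false colC vfree deg vdeg neqRB p_surj pR pB h_gt0) => //.
- by rewrite card_ord.
- by rewrite cardS addn1.
Qed.

Lemma even_star_upper k h : 0 < k -> 5 < h ->
  gallai_ramsey_prop k (star (2 * h)) (complete_star (5 * h - 4) (4 * h - 2)).
Proof.
move=> k_gt0 h_gt5; apply: complete_star_prop => //; try lia.
move=> col vcol S colC free vfree deg vdeg cardS.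
have deg0 x a : #|[set y | (y != x) && (col x y == a)]| <= (2 * h).-1.
  exact: leq_trans (leq_addr _ _) (deg x a).
have [||p [R [B [neqRB p_surj pR pB]]]] := pentagonal_structure colC free deg0.
(* The next goal, 7(2h - 1) < 3(5h - 4), amounts to h > 5: here m >= 12 enters. *)
- by lia.
- by rewrite card_ord; lia.
apply: (even_extension_false colC vfree deg vdeg neqRB p_surj pR pB h_gt5).
- by lia.
- by rewrite card_ord; lia.
- by rewrite cardS; lia.
Qed.

(** * Lower bounds *)

(* The blow-up coloring of the pentagon [0 - 1 - 2 - 3 - 4 - 0] (color 0) and its
   complement (color 1), with color 2 inside the parts; the label 5 is joined to
   everything in color 2. *)
Definition label_col (i j : nat) : nat :=
  if [|| i == j, i == 5 | j == 5] then 2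
  else if (j == i.+1 %% 5) || (i == j.+1 %% 5) then 0 else 1.

Lemma label_colC i j : label_col i j = label_col j i.
Proof.
by rewrite /label_col eq_sym [(i == 5) || _]orbC [(j == i.+1 %% 5) || _]orbC.
Qed.

Lemma label_col_lt3 i j : label_col i j < 3.
Proof. by rewrite /label_col; do 2 case: ifP => // _. Qed.

(** Checked on all triples of labels, repetitions included, so triangles meeting a part twice are
    covered. *)
Lemma label_col_free i j l : i < 6 -> j < 6 -> l < 6 ->
  ~~ uniq [:: label_col i j; label_col j l; label_col i l].
Proof.
move=> lt_i lt_j lt_l.
pose ok i j l := ~~ uniq [:: label_col i j; label_col j l; label_col i l].
have all_ok : all (fun i => all (fun j => all (ok i j) (iota 0 6)) (iota 0 6)) (iota 0 6) by [].
have mem6 x : x < 6 -> x \in iota 0 6 by rewrite mem_iota.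
by have /allP/(_ _ (mem6 j lt_j))/allP/(_ _ (mem6 l lt_l)) := allP all_ok _ (mem6 i lt_i).
Qed.

Lemma label_coloring_lower k m (G : sgraph) (lab : G -> nat) :
    2 < k -> 0 < m -> (forall x, lab x < 6) ->
    (forall x a, #|[set y | adj x y && (label_col (lab x) (lab y) == a)]| < m) ->
  ~ gallai_ramsey_prop k (star m) G.
Proof.
move=> k_gt2 m_gt0 lab_lt6 deg propG.
pose col (x y : G) := Ordinal (leq_trans (label_col_lt3 (lab x) (lab y)) k_gt2).
have k_gt0 : 0 < k := ltnW (ltnW k_gt2).
have colC x y : col x y = col y x by apply: val_inj; rewrite /= label_colC.
have [[x [y [z [_ _ _]]]]|[x [a]]] := (gallai_ramsey_starP _ k_gt0 m_gt0).1 propG col colC.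
  rewrite -(map_inj_uniq val_inj); apply/negP.
  by apply: label_col_free.
by apply/negP; rewrite -ltnNge; apply: leq_ltn_trans (deg x a).
Qed.

Lemma card_ord_interval N lo w (P : pred 'I_N) :
  (forall z, P z -> lo <= z < lo + w) -> #|[set z | P z]| <= w.
Proof.
move=> Pint; rewrite cardE -(size_map val) -[leqRHS](size_iota lo).
apply: uniq_leq_size; first by rewrite map_inj_uniq ?enum_uniq //; apply: val_inj.
by move=> _ /mapP[z + ->]; rewrite mem_enum inE mem_iota => /Pint.
Qed.

Lemma complete_star_center_degree N s (P : pred (complete_star N s)) :
  #|[set y | @adj (complete_star N s) None y && P y]| <= s.
Proof.
apply: leq_trans (_ : #|Some @: [set z : 'I_N | z < s]| <= s).
  by apply/subset_leq_card/subsetP; case=> [z|]; rewrite !inE // => /andP[zs _];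
     rewrite imset_f ?inE.
by rewrite card_imset; [apply: (@card_ord_interval _ 0) | apply: ord_some_inj].
Qed.

Ltac eval_label_col :=
  repeat match goal with |- context [label_col ?i ?j] =>
    let c := eval vm_compute in (label_col i j) in change (label_col i j) with c
  end.

Section StarLabels.

Variables (N s v : nat) (q : 'I_N -> 'I_5).

(** [v] labels the added vertex: 5 for odd m, the label of a small part for even m. *)
Definition star_label (x : complete_star N s) : nat := if x is Some z then q z else v.

(** Whole parts are counted, even [x] itself and non-neighbors of [None]; the resulting bounds are
    still good enough where it is applied. *)
Lemma star_label_degree x a :
  #|[set y | adj x y && (label_col (star_label x) (star_label y) == a)]| <=
  (adj x None && (label_col (star_label x) v == a)) +
  \sum_(j < 5) (label_col (star_label x) j == a) * #|[set z | q z == j]|.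
Proof.
rewrite (cardsD1 None) inE leq_add2l.
pose F (j : 'I_5) := label_col (star_label x) j == a.
have -> : \sum_(j < 5) F j * #|[set z | q z == j]| = #|[set z | F (q z)]|.
  rewrite -[RHS]sum1_card (partition_big q predT) //=; apply: eq_bigr => j _.
  rewrite -sum1_card; case Fj: (F j); rewrite ?mul1n ?mul0n.
    by apply: eq_bigl => z; rewrite !inE andb_idl // => /eqP->.
  by rewrite big_pred0 // => z; rewrite inE; apply: contraFF Fj => /andP[+ /eqP<-].
rewrite -[leqRHS](card_imset _ (@ord_some_inj N)); apply/subset_leq_card/subsetP.
case=> [z|]; rewrite !inE //= => /andP[_ Fz].
by apply: imset_f; rewrite inE.
Qed.

End StarLabels.

Lemma odd_star_lower k h : 2 < k -> 0 < h ->
  ~ gallai_ramsey_prop k (star (2 * h + 1)) (complete_star (5 * h) (2 * h)).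
Proof.
move=> k_gt2 h_gt0.
have q_lt (z : 'I_(5 * h)) : z %/ h < 5 by rewrite ltn_divLR.
pose q z := Ordinal (q_lt z).
(* The parts are five blocks of h vertices. All 2h edges at [None] have color 2, in which other
   vertices have degree at most h + 1. *)
apply: (@label_coloring_lower _ _ _ (@star_label _ _ 5 q)) => //; first by lia.
  by case=> [z|] //=; apply: ltnW (q_lt z).
have part_le (j : 'I_5) : #|[set z | q z == j]| <= h.
  apply: (@card_ord_interval _ (j * h)) => z /eqP/(congr1 val)/= <-.
  by rewrite leq_divM -mulSnr ltn_ceil.
case=> [z|] a; last by apply: leq_ltn_trans (complete_star_center_degree _) _; lia.
apply: leq_ltn_trans (@star_label_degree _ _ 5 q (Some z) a) _.
rewrite !big_ord_recl big_ord0 /= addn0.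
have := part_le ord0; have := part_le (lift ord0 ord0).
have := part_le (lift ord0 (lift ord0 ord0)).
have := part_le (lift ord0 (lift ord0 (lift ord0 ord0))).
have := part_le (lift ord0 (lift ord0 (lift ord0 (lift ord0 ord0)))).
move: #|_| #|_| #|_| #|_| #|_| => a4 a3 a2 a1 a0; move: (z < 2 * h) => b.
move: (z %/ h) (q_lt z) => i lt_i; clear - h_gt0 lt_i.
by case: i lt_i => [|[|[|[|[|//]]]]] _; case: a => [|[|[|a]]]; eval_label_col => /=; lia.
Qed.

Lemma even_star_lower k h : 2 < k -> 1 < h ->
  ~ gallai_ramsey_prop k (star (2 * h)) (complete_star (5 * h - 4) (4 * h - 3)).
Proof.
move=> k_gt2 h_gt1.
(* The truncated predecessor puts both 0 and 1 into block 0, which thus has h vertices against h - 1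
   in the others. *)
have q_lt (z : 'I_(5 * h - 4)) : z.-1 %/ h.-1 < 5.
  by rewrite ltn_divLR; have := ltn_ord z; lia.
pose q z := Ordinal (q_lt z).
apply: (@label_coloring_lower _ _ _ (@star_label _ _ 3 q)) => //; first by lia.
  by case=> [z|] //=; apply: ltnW (q_lt z).
have part_int (z : 'I_(5 * h - 4)) : q z * h.-1 <= z.-1 < (q z).+1 * h.-1.
  by rewrite leq_divM ltn_ceil //; lia.
have part_le (j : 'I_5) : #|[set z | q z == j]| <= h.-1 + (j == 0 :> nat).
  apply: (@card_ord_interval _ (j * h.-1 + (j != 0 :> nat))) => z /eqP <-.
  by have := part_int z; case: eqP => [->|/eqP] /=; rewrite ?mulSn; lia.
have := part_le (lift ord0 (lift ord0 (lift ord0 (lift ord0 ord0)))).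
have := part_le (lift ord0 (lift ord0 (lift ord0 ord0))).
have := part_le (lift ord0 (lift ord0 ord0)).
have := part_le (lift ord0 ord0); have := part_le ord0.
move=> le0 le1 le2 le3 le4.
move=> x a; apply: leq_ltn_trans (@star_label_degree _ _ 3 q x a) _.
rewrite !big_ord_recl big_ord0 addn0; case: x => [z|] /=.
  (* Part 4 already has h + (h - 1) neighbors of color 0, in parts 0 and 3; the first 4h - 3
     vertices are exactly those outside it. *)
  have : (z.-1 %/ h.-1 == 4) ==> ~~ (z < 4 * h - 3).
    by apply/implyP => /eqP qz; have := part_int z; rewrite /= qz; lia.
  move: le0 le1 le2 le3 le4; move: #|_| #|_| #|_| #|_| #|_| => a0 a1 a2 a3 a4.
  move: (z < 4 * h - 3) => b.
  move: (z.-1 %/ h.-1) (q_lt z) => i lt_i; clear - h_gt1 lt_i.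
  by case: i lt_i => [|[|[|[|[|//]]]]] _; case: a => [|[|[|a]]];
    eval_label_col; case: b => //=; lia.
move: le0 le1 le2 le3 le4; move: #|_| #|_| #|_| #|_| #|_| => a0 a1 a2 a3 a4.
by clear - h_gt1; case: a => [|[|[|a]]]; eval_label_col => /=; lia.
Qed.

(** * From the two bounds to the star-critical number *)

(** The same two bounds also give the Gallai-Ramsey number N + 1: the graph with s extra edges
    embeds in K_{N+1}, and K_n with n <= N embeds in the graph with s - 1 extra edges. Minimality of
    s follows by monotonicity. *)
Lemma is_star_critical_star k m N s :
    0 < s -> s <= N ->
    gallai_ramsey_prop k (star m) (complete_star N s) ->
    ~ gallai_ramsey_prop k (star m) (complete_star N s.-1) ->
  is_star_critical k (star m) s.
Proof.
move=> s_gt0 le_sN upper lower; exists N.+1; rewrite /=; split; split=> //.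
- pose g (x : complete_star N s) : complete N.+1 :=
    if x is Some z then lift ord0 z else ord0.
  apply: (@gallai_ramsey_prop_sub _ _ _ _ g) upper; split.
    by case=> [z|] [z'|] //= /lift_inj->.
  by case=> [z|] [z'|].
- move=> n propn; rewrite ltnNge; apply/negP => le_nN; apply: lower.
  pose g (x : complete n) : complete_star N s.-1 := Some (widen_ord le_nN x).
  apply: (@gallai_ramsey_prop_sub _ _ _ _ g) propn; split.
    by move=> x y [] /val_inj.
  by move=> x y neq_xy; apply: contraNneq neq_xy => -[] /val_inj->.
move=> s' [_ props']; rewrite leqNgt; apply/negP => lt_s's; apply: lower.
pose g (x : complete_star N s') : complete_star N s.-1 := x.
apply: (@gallai_ramsey_prop_sub _ _ _ _ g) props'; split=> // -[x|] [y|] //=.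
  by move=> ?; lia.
by move=> ?; lia.
Qed.

Theorem theorem4p6 (k m : nat) (hk : 3 <= k) :
  (12 <= m -> ~~ odd m -> is_star_critical k (star m) (2 * m - 2)) /\
  (3 <= m -> odd m -> is_star_critical k (star m) m).
Proof.
have k_gt0 : 0 < k := ltnW (ltnW hk).
split=> le_m m_odd.
  have [h def_m] : exists h, m = 2 * h by exists m./2; lia.
  have h_gt5 : 5 < h by lia.
  have -> : 2 * m - 2 = 4 * h - 2 by lia.
  rewrite def_m; apply: (@is_star_critical_star _ _ (5 * h - 4)); try lia.
    exact: even_star_upper.
  have -> : (4 * h - 2).-1 = 4 * h - 3 by lia.
  by apply: even_star_lower; rewrite // (leq_trans _ h_gt5).
have [h def_m] : exists h, m = 2 * h + 1 by exists m./2; lia.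
have h_gt0 : 0 < h by lia.
rewrite def_m; apply: (@is_star_critical_star _ _ (5 * h)); try lia.
  exact: odd_star_upper.
have -> : (2 * h + 1).-1 = 2 * h by lia.
exact: odd_star_lower.
Qed.
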